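(* The elements $$A^i B^j C^k D^\ell \alpha^r \beta^s\qquad\text{for all } i,j,k,\ell,r,s\in\mathbb N$$ are an $\mathbb F$-basis for $\Re$.
   Context: $\mathbb F$ is a field with $\operatorname{char}\mathbb F\neq 2$; $\mathbb N$ is the set of nonnegative integers. Algebras are associative with unit $1$. $[a,b]=ab-ba$. The Racah algebra $\Re$ is the $\mathbb F$-algebra defined by generators $A,B,C,D$ and the relations asserting that $[A,B]=[B,C]=[C,A]=2D$ and that each of $\alpha=[A,D]+AC-BA$, $\beta=[B,D]+BA-CB$, $\gamma=[C,D]+CB-AC$ is central in $\Re$. *)

(* Defs.v *)
From HB Require Import structures.
From mathcomp Require Import all_boot all_algebra.
From mathcomp Require Import finmap monalg boolp.

Set Implicit Arguments.
Unset Strict Implicit.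
Unset Printing Implicit Defensive.

Import GRing.Theory.

Local Open Scope ring_scope.
Local Open Scope quotient_scope.

Definition lie (R : pzRingType) (x y : R) : R := x * y - y * x.

(* Written for any ring, so as to be used both in the free algebra and in the
   quotient. *)
Section Elements.
Variables (R : pzRingType) (A B C D : R).

Definition alpha_of : R := lie A D + A * C - B * A.
Definition beta_of  : R := lie B D + B * A - C * B.
Definition gamma_of : R := lie C D + C * B - A * C.

End Elements.

(* Bases are families, not sets: two distinct indices carrying the same vector
   make the family dependent. *)
Definition lin_indep (F : fieldType) (V : lmodType F) (J : eqType)
    (v : J -> V) : Prop :=
  forall (s : seq J) (c : J -> F), uniq s ->
    \sum_(j <- s) c j *: v j = 0 -> forall j, j \in s -> c j = 0.

Definition lin_span (F : fieldType) (V : lmodType F) (J : eqType)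
    (v : J -> V) : Prop :=
  forall x : V, exists (s : seq J) (c : J -> F), x = \sum_(j <- s) c j *: v j.

Definition is_basis (F : fieldType) (V : lmodType F) (J : eqType)
    (v : J -> V) : Prop :=
  lin_indep v /\ lin_span v.

Inductive ideal_gen (R : pzRingType) (S : R -> Prop) : R -> Prop :=
| ideal_gen_in x : S x -> ideal_gen S x
| ideal_gen_0 : ideal_gen S 0
| ideal_gen_add x y : ideal_gen S x -> ideal_gen S y -> ideal_gen S (x + y)
| ideal_gen_mull a x : ideal_gen S x -> ideal_gen S (a * x)
| ideal_gen_mulr a x : ideal_gen S x -> ideal_gen S (x * a).

(* The quotient [R / (S)] of an algebra by the two-sided ideal generated by [S]. *)
Section Presented.
Variables (F : pzRingType) (R : lalgType F) (S : R -> Prop).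

Definition ideal_pred : {pred R} := fun x => `[< ideal_gen S x >].

Lemma ideal_predP x : reflect (ideal_gen S x) (x \in ideal_pred).
Proof. exact: asboolP. Qed.

Lemma ideal_pred_mull a x : x \in ideal_pred -> a * x \in ideal_pred.
Proof. by move/ideal_predP => h; apply/ideal_predP/ideal_gen_mull. Qed.

Lemma ideal_pred_mulr a x : x \in ideal_pred -> x * a \in ideal_pred.
Proof. by move/ideal_predP => h; apply/ideal_predP/ideal_gen_mulr. Qed.

Lemma ideal_pred_zmod : zmod_closed ideal_pred.
Proof.
split; first by apply/ideal_predP/ideal_gen_0.
move=> x y /ideal_predP hx /ideal_predP hy; apply/ideal_predP.
by apply: ideal_gen_add => //; rewrite -mulN1r; apply: ideal_gen_mull.
Qed.

HB.instance Definition _ :=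
  GRing.isZmodClosed.Build R ideal_pred ideal_pred_zmod.

Definition presented : Type := Quotient.quot ideal_pred.
HB.instance Definition _ :=
  ZmodQuotient.copy presented (Quotient.quot ideal_pred).

Definition proj (x : R) : presented := \pi_presented x.

Lemma projP x y : reflect (proj x = proj y) (x - y \in ideal_pred).
Proof. by rewrite Quotient.idealrBE; apply: eqP. Qed.

Lemma projD x y : proj (x + y) = proj x + proj y.
Proof. exact: (raddfD \pi_presented). Qed.

Lemma reprK_proj (u : presented) : proj (repr u) = u.
Proof. exact: reprK. Qed.

Lemma proj_surj (u : presented) : {x | u = proj x}.
Proof. by exists (repr u); rewrite reprK_proj. Qed.

Definition presented_mul (u v : presented) := proj (repr u * repr v).
Definition presented_scale (a : F) (u : presented) := proj (a *: repr u).

Lemma proj_mul x y : presented_mul (proj x) (proj y) = proj (x * y).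
Proof.
have hr z : repr (proj z) - z \in ideal_pred by apply/projP; rewrite reprK_proj.
apply/projP; rewrite -[X in X - _](subrK (repr (proj x) * y)) -mulrBr -addrA.
by rewrite -mulrBl rpredD //; [exact: ideal_pred_mull|exact: ideal_pred_mulr].
Qed.

Lemma proj_scale a x : presented_scale a (proj x) = proj (a *: x).
Proof.
apply/projP; rewrite -scalerBr -mulr_algl ideal_pred_mull //.
by apply/projP; rewrite reprK_proj.
Qed.

Lemma presented_mulA : associative presented_mul.
Proof.
move=> u v w.
have [[[x ->] [y ->]] [z ->]] := (proj_surj u, proj_surj v, proj_surj w).
by rewrite !proj_mul mulrA.
Qed.

Lemma presented_mul1 : left_id (proj 1) presented_mul.
Proof. by move=> u; have [x ->] := proj_surj u; rewrite proj_mul mul1r. Qed.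

Lemma presented_mulr1 : right_id (proj 1) presented_mul.
Proof. by move=> u; have [x ->] := proj_surj u; rewrite proj_mul mulr1. Qed.

Lemma presented_mulDl : left_distributive presented_mul +%R.
Proof.
move=> u v w.
have [[[x ->] [y ->]] [z ->]] := (proj_surj u, proj_surj v, proj_surj w).
by rewrite -projD !proj_mul mulrDl projD.
Qed.

Lemma presented_mulDr : right_distributive presented_mul +%R.
Proof.
move=> u v w.
have [[[x ->] [y ->]] [z ->]] := (proj_surj u, proj_surj v, proj_surj w).
by rewrite -projD !proj_mul mulrDr projD.
Qed.

HB.instance Definition _ := GRing.Zmodule_isPzRing.Build presented
  presented_mulA presented_mul1 presented_mulr1 presented_mulDl presented_mulDr.

Lemma presented_scaleA a b u :
  presented_scale a (presented_scale b u) = presented_scale (a * b) u.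
Proof. by have [x ->] := proj_surj u; rewrite !proj_scale scalerA. Qed.

Lemma presented_scale1 : left_id 1 presented_scale.
Proof. by move=> u; have [x ->] := proj_surj u; rewrite proj_scale scale1r. Qed.

Lemma presented_scaleDr : right_distributive presented_scale +%R.
Proof.
move=> a u v; have [[x ->] [y ->]] := (proj_surj u, proj_surj v).
by rewrite -projD !proj_scale scalerDr projD.
Qed.

Lemma presented_scaleDl u : {morph presented_scale^~ u : a b / a + b}.
Proof.
by move=> a b; have [x ->] := proj_surj u; rewrite !proj_scale scalerDl projD.
Qed.

HB.instance Definition _ := GRing.Zmodule_isLmodule.Build F presented
  presented_scaleA presented_scale1 presented_scaleDr presented_scaleDl.

Lemma projM x y : proj (x * y) = proj x * proj y.
Proof. by rewrite -proj_mul. Qed.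

Lemma projZ a x : proj (a *: x) = a *: proj x.
Proof. by rewrite -proj_scale. Qed.

Lemma proj_zmod_morphism : zmod_morphism proj.
Proof. exact: (raddfB \pi_presented). Qed.

Lemma proj_monoid_morphism : monoid_morphism proj.
Proof. by split=> //; apply: projM. Qed.

HB.instance Definition _ :=
  GRing.isZmodMorphism.Build R presented proj proj_zmod_morphism.
HB.instance Definition _ :=
  GRing.isMonoidMorphism.Build R presented proj proj_monoid_morphism.

Lemma proj_rel x : S x -> proj x = 0.
Proof.
move=> Sx; rewrite -(rmorph0 proj); apply/projP; rewrite subr0.
by apply/ideal_predP/ideal_gen_in.
Qed.

Lemma presented_scaleAl (a : F) (u v : presented) : a *: (u * v) = (a *: u) * v.
Proof.
have [[x ->] [y ->]] := (proj_surj u, proj_surj v).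
by rewrite -(projM x y) -!projZ -projM scalerAl.
Qed.

Lemma presented_scaleAr :
  (forall a (x y : R), a *: (x * y) = x * (a *: y)) ->
  forall (a : F) (u v : presented), a *: (u * v) = u * (a *: v).
Proof.
move=> h a u v; have [[x ->] [y ->]] := (proj_surj u, proj_surj v).
by rewrite -(projM x y) -!projZ -projM h.
Qed.

Lemma presented_oner_neq0 : 1 \notin ideal_pred -> (1 : presented) != 0.
Proof.
move=> h; apply/eqP; rewrite -[RHS](raddf0 \pi_presented) => /projP.
by rewrite subr0 (negPf h).
Qed.

Lemma proj_lie x y : proj (lie x y) = lie (proj x) (proj y).
Proof. by rewrite rmorphB !rmorphM. Qed.

Lemma proj_alpha A B C D :
  proj (alpha_of A B C D) = alpha_of (proj A) (proj B) (proj C) (proj D).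
Proof. by rewrite rmorphB rmorphD /= proj_lie !rmorphM. Qed.

Lemma proj_beta A B C D :
  proj (beta_of A B C D) = beta_of (proj A) (proj B) (proj C) (proj D).
Proof. by rewrite rmorphB rmorphD /= proj_lie !rmorphM. Qed.

Lemma proj_gamma A B C D :
  proj (gamma_of A B C D) = gamma_of (proj A) (proj B) (proj C) (proj D).
Proof. by rewrite rmorphB rmorphD /= proj_lie !rmorphM. Qed.

Lemma proj_lie_double x y z :
  S (lie x y - z *+ 2) -> lie (proj x) (proj y) = proj z *+ 2.
Proof.
move/proj_rel; rewrite rmorphB rmorphMn /= proj_lie => /eqP.
by rewrite subr_eq0 => /eqP.
Qed.

Lemma proj_lie_central x :
  (forall y, S (lie x y)) -> forall u, proj x * u = u * proj x.
Proof.
move=> h u; have [y ->] := proj_surj u; apply/eqP; rewrite -subr_eq0.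
by rewrite -[X in X == _]/(lie _ _) -proj_lie proj_rel.
Qed.

End Presented.

Lemma ideal_gen_rmorph (R : pzRingType) (S : pzRingType) (f : {rmorphism R -> S})
    (rel : R -> Prop) :
  (forall x, rel x -> f x = 0) -> forall x, ideal_gen rel x -> f x = 0.
Proof.
move=> hrel x; elim=> {x} [x /hrel //||x y _ hx _ hy|a x _ h|a x _ h].
- exact: rmorph0.
- by rewrite rmorphD hx hy addr0.
- by rewrite rmorphM h mulr0.
- by rewrite rmorphM h mul0r.
Qed.

Lemma rmorph_lie0 (R : pzRingType) (S : comPzRingType) (f : {rmorphism R -> S}) x y :
  f (lie x y) = 0.
Proof. by rewrite rmorphB !rmorphM mulrC subrr. Qed.

(* The free unital associative algebra on four generators, as the monoid
   algebra of the monoid of words on four letters. *)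
Notation free4 F := {malg F[{fmonom 'I_4}]}.

Lemma malg_scaleAr (K : monomType) (R : comNzRingType) (a : R)
    (x y : {malg R[K]}) :
  a *: (x * y) = x * (a *: y).
Proof.
apply/malgP => k; rewrite mcoeffZ mcoeffMl.
rewrite (mcoeffMlw _ (fsubset_refl _) (msuppZ_le _ _)) mulr_sumr.
apply: eq_bigr => k1 _; rewrite mulr_sumr; apply: eq_bigr => k2 _.
by rewrite mcoeffZ mulrnAr mulrCA.
Qed.

Section Racah.
Variable F : fieldType.

Definition fgen (i : 'I_4) : free4 F := << fmu i >>.
Definition fA := fgen (@Ordinal 4 0 isT).
Definition fB := fgen (@Ordinal 4 1 isT).
Definition fC := fgen (@Ordinal 4 2 isT).
Definition fD := fgen (@Ordinal 4 3 isT).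

(* Each constructor gives elements that must vanish; an element is central in
   the quotient iff its commutators with all images of free elements vanish. *)
Inductive racah_rel : free4 F -> Prop :=
| racah_rel_AB : racah_rel (lie fA fB - fD *+ 2)
| racah_rel_BC : racah_rel (lie fB fC - fD *+ 2)
| racah_rel_CA : racah_rel (lie fC fA - fD *+ 2)
| racah_rel_alpha x : racah_rel (lie (alpha_of fA fB fC fD) x)
| racah_rel_beta x : racah_rel (lie (beta_of fA fB fC fD) x)
| racah_rel_gamma x : racah_rel (lie (gamma_of fA fB fC fD) x).

(* The relations have no constant terms. *)
Lemma racah_rel_coef1 (x : free4 F) : ideal_gen racah_rel x -> mcoeff mone x = 0.
Proof.
have cD : mcoeff mone fD = 0 by rewrite mcoeffU1 fm1_eq1.
pose ct : {rmorphism free4 F -> F} := mcoeff mone.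
have {}cD : ct fD = 0 by exact: cD.
move=> h; apply: (ideal_gen_rmorph (f := ct)) h; clearbody ct => {}x.
case=> [|||u|u|u]; only 4-6: exact: rmorph_lie0.
all: by rewrite rmorphB rmorphMn /= cD mul0rn subr0 rmorph_lie0.
Qed.

Lemma racah_ideal1 : 1 \notin ideal_pred racah_rel.
Proof.
apply/negP => /ideal_predP/racah_rel_coef1/eqP.
by rewrite mcoeff1 eqxx oner_eq0.
Qed.

Definition racah : Type := presented racah_rel.
HB.instance Definition _ := GRing.PzRing.on racah.
HB.instance Definition _ := GRing.Lmodule.on racah.
HB.instance Definition _ :=
  GRing.PzSemiRing_isNonZero.Build racah (presented_oner_neq0 racah_ideal1).
HB.instance Definition _ :=
  GRing.Lmodule_isLalgebra.Build F racah (@presented_scaleAl _ _ racah_rel).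
HB.instance Definition _ :=
  GRing.Lalgebra_isAlgebra.Build F racah
    (@presented_scaleAr _ _ racah_rel (@malg_scaleAr _ _)).

Definition rA : racah := proj racah_rel fA.
Definition rB : racah := proj racah_rel fB.
Definition rC : racah := proj racah_rel fC.
Definition rD : racah := proj racah_rel fD.
Definition ralpha : racah := alpha_of rA rB rC rD.
Definition rbeta : racah := beta_of rA rB rC rD.
Definition rgamma : racah := gamma_of rA rB rC rD.

Lemma racah_AB : lie rA rB = rD *+ 2.
Proof. exact: proj_lie_double (racah_rel_AB). Qed.

Lemma racah_BC : lie rB rC = rD *+ 2.
Proof. exact: proj_lie_double (racah_rel_BC). Qed.

Lemma racah_CA : lie rC rA = rD *+ 2.
Proof. exact: proj_lie_double (racah_rel_CA). Qed.

Lemma racah_alpha_central (u : racah) : ralpha * u = u * ralpha.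
Proof.
rewrite /ralpha -proj_alpha; apply: proj_lie_central => x.
exact: racah_rel_alpha.
Qed.

Lemma racah_beta_central (u : racah) : rbeta * u = u * rbeta.
Proof.
rewrite /rbeta -proj_beta; apply: proj_lie_central => x.
exact: racah_rel_beta.
Qed.

Lemma racah_gamma_central (u : racah) : rgamma * u = u * rgamma.
Proof.
rewrite /rgamma -proj_gamma; apply: proj_lie_central => x.
exact: racah_rel_gamma.
Qed.

End Racah.

(* Main.v *)
From HB Require Import structures.
Require Import Defs.
From mathcomp Require Import all_boot all_algebra.
From mathcomp Require Import zify ring finmap ssrcomplements mpoly.
From mathcomp Require monalg.

(* Spanning. Give A, B, C, D, alpha, beta the weights 2, 2, 2, 3, 4, 4. Every
   commutator of two of these generators is a combination of words of smaller
   weight than the product; for [C, D] this uses alpha + beta + gamma = 0, where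
   char F <> 2 enters: A + B + C commutes with 2D = [A, B]. Hence permuting the
   letters of a word changes it only by words of smaller weight.

   Independence. As A + B + C is central, write C = delta - A - B and let the
   algebra act on F[x, y, delta, z, al, be], the left module induced from
   F[D, delta, alpha, beta], with A acting as multiplication by x. The operators
   b, d of B, D commute with delta, z, al, be, and the relations [A, B] = 2D and
   [A, D] + AC - BA = alpha determine them from b(y^k) = y^(k+1) and d(y^k). The
   values d(y^k) are obtained recursively from the last relation, imposed on the
   vectors y^k; a Jacobi-type computation shows that it then holds everywhere.
   Up to terms of lower total degree, B and C act as multiplication by y and
   delta - x - y. So, after the substitution of delta + x + y for delta, applying
   A^i B^j C^k D^l alpha^r beta^s to 1 gives the monomial with these exponents
   plus terms of lower degree. *)

Set Implicit Arguments.
Unset Strict Implicit.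
Unset Printing Implicit Defensive.

Import GRing.Theory.

Local Open Scope ring_scope.

Local Notation i0 := (@Ordinal 6 0 isT).
Local Notation i1 := (@Ordinal 6 1 isT).
Local Notation i2 := (@Ordinal 6 2 isT).
Local Notation i3 := (@Ordinal 6 3 isT).
Local Notation i4 := (@Ordinal 6 4 isT).
Local Notation i5 := (@Ordinal 6 5 isT).

(** * Linear maps and linear independence *)

Section LinearExtension.
Variables (n : nat) (R : comNzRingType) (W : lmodType R) (f : 'X_{1..n} -> W).

Definition mlift (p : {mpoly R[n]}) : W := \sum_(m <- msupp p) p@_m *: f m.

Lemma mliftEw d p : (msize p <= d)%N ->
  mlift p = \sum_(m : 'X_{1..n < d}) p@_m *: f m.
Proof.
move=> hp; rewrite /mlift (big_mksub 'X_{1..n < d}) ?msupp_uniq //=.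
  rewrite big_rmcond //= => m /memN_msupp_eq0 ->; exact: scale0r.
by move=> m /msize_mdeg_lt /leq_trans; apply.
Qed.

Lemma mlift_linear : linear mlift.
Proof.
move=> c p q; set d := maxn (msize p) (maxn (msize q) (msize (c *: p + q))).
rewrite !(mliftEw (d := d)) /d ?leq_max ?leqnn ?orbT //.
rewrite scaler_sumr -big_split; apply: eq_bigr => m _ /=.
by rewrite mcoeffD mcoeffZ scalerDl scalerA.
Qed.

HB.instance Definition _ := GRing.isLinear.Build R {mpoly R[n]} W _ mlift mlift_linear.

Lemma mliftX m : mlift 'X_[m] = f m.
Proof. by rewrite /mlift msuppX big_seq1 mcoeffX eqxx scale1r. Qed.

End LinearExtension.

Lemma big_ord6 (T : Type) (idx : T) (op : Monoid.law idx) (f : 'I_6 -> T) :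
  \big[op/idx]_(i < 6) f i =
  op (f i0) (op (f i1) (op (f i2) (op (f i3) (op (f i4) (f i5))))).
Proof.
rewrite !big_ord_recl big_ord0 Monoid.mulm1.
by congr (op (f _) (op (f _) (op (f _) (op (f _) (op (f _) (f _)))))); exact/val_inj.
Qed.

(** Since [msize] is the degree plus one, each [q j] is the monomial of [e j] plus terms of strictly
    lower degree. In a relation the coefficients therefore vanish in order of decreasing degree. *)
Lemma lead_lin_indep (n : nat) (F : fieldType) (J : eqType)
    (e : J -> 'X_{1..n}) (q : J -> {mpoly F[n]}) :
  injective e -> (forall j, msize (q j - 'X_[e j]) <= mdeg (e j))%N ->
  lin_indep q.
Proof.
move=> e_inj hq s c s_uniq sum0.
pose N := (\max_(j <- s) mdeg (e j))%N.
(* The number [k] bounds how far the degree of [e j] lies below the maximum [N]. *)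
suff h k j : j \in s -> (N < mdeg (e j) + k)%N -> c j = 0.
  by move=> j js; apply: (h N.+1) => //; rewrite addnS ltnS leq_addl.
elim: k j => [|k IH] j js hj.
  move: hj; rewrite addn0 ltnNge /N.
  by rewrite (@leq_bigmax_seq _ _ xpredT (fun j => mdeg (e j))).
(* In the coefficient of [e j], terms of larger degree are gone by induction and the others miss
   this monomial, except [j] itself. *)
have := congr1 (mcoeff (e j)) sum0.
rewrite mcoeff0 raddf_sum /= (bigD1_seq j) //= big_seq_cond big1 ?addr0.
  rewrite mcoeffZ -[q j](subrK 'X_[e j]) mcoeffD mcoeffX eqxx.
  by rewrite memN_msupp_eq0 ?add0r ?mulr1 // msize_mdeg_ge.
move=> j' /andP[j's j'j]; rewrite mcoeffZ.
have [lt_j|le_j] := ltnP (mdeg (e j)) (mdeg (e j')).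
  rewrite (IH j' j's) ?mul0r //; lia.
rewrite -[q j'](subrK 'X_[e j']) mcoeffD mcoeffX (inj_eq e_inj) (negPf j'j) addr0.
by rewrite memN_msupp_eq0 ?mulr0 // msize_mdeg_ge // (leq_trans _ le_j).
Qed.

Lemma lin_indep_linear (F : fieldType) (U V : lmodType F) (J : eqType)
    (f : {linear U -> V}) (v : J -> U) :
  lin_indep (f \o v) -> lin_indep v.
Proof.
move=> h s c s_uniq sum0; apply: h => //.
rewrite -[RHS](linear0 f) -sum0 linear_sum.
by apply: eq_bigr => j _; rewrite linearZ.
Qed.

(** * Actions of the free algebra *)

Section FreeAction.
Import monalg.
Variables (F : fieldType) (V : lmodType F) (op : 'I_4 -> {linear V -> V}).

Definition word_act (w : seq 'I_4) (v : V) : V := foldr (fun i => op i) v w.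

Lemma word_act_linear w : linear (word_act w).
Proof.
by move=> a u v; elim: w => //= i w ->; rewrite linearP.
Qed.

HB.instance Definition _ w := GRing.isLinear.Build F V V _
  (word_act w) (word_act_linear w).

Definition free_act (u : free4 F) (v : V) : V :=
  \sum_(k <- msupp u) mcoeff k u *: word_act k v.

(** Enlarging the index set lets sums over different supports be added term by term. *)
Lemma free_actEw (d : {fset (fmonom 'I_4 : choiceType)}) u v :
  (msupp u `<=` d)%fset ->
  free_act u v = \sum_(k <- d) mcoeff k u *: word_act k v.
Proof.
move=> le; rewrite /free_act (big_fset_incl _ le) //.
by move=> k _ /mcoeff_outdom ->; rewrite scale0r.
Qed.

Lemma free_act_linear v : linear (free_act^~ v).
Proof.
move=> c u w /=.
pose d := (msupp u `|` msupp w `|` msupp (c *: u + w))%fset.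
have hu : (msupp u `<=` d)%fset by rewrite /d -fsetUA fsubsetUl.
have hw : (msupp w `<=` d)%fset by rewrite /d fsubsetU // fsubsetUr.
have huw : (msupp (c *: u + w) `<=` d)%fset by rewrite /d fsubsetUr.
rewrite !(free_actEw _ hu, free_actEw _ hw, free_actEw _ huw).
rewrite scaler_sumr -big_split; apply: eq_bigr => k _ /=.
by rewrite mcoeffD mcoeffZ scalerDl scalerA.
Qed.

Definition free_act_at v u := free_act u v.
HB.instance Definition _ v := GRing.isLinear.Build F (free4 F) V _
  (free_act_at v) (free_act_linear v).

Lemma free_act_linearr u : linear (free_act u).
Proof.
move=> c v w; rewrite /free_act scaler_sumr -big_split; apply: eq_bigr => k _ /=.
by rewrite word_act_linear scalerDr !scalerA mulrC.
Qed.

HB.instance Definition _ u := GRing.isLinear.Build F V V _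
  (free_act u) (free_act_linearr u).

Lemma free_actU c k v : free_act (mkmalgU k c) v = c *: word_act k v.
Proof.
rewrite (free_actEw _ msuppU_le) big_seq_fset1.
by rewrite mcoeffUU.
Qed.

Lemma free_actM u w v : free_act (u * w) v = free_act u (free_act w v).
Proof.
rewrite malgME -/(free_act_at v _) linear_sum [RHS]/free_act.
apply: eq_bigr => k1 _; rewrite !linear_sum.
apply: eq_bigr => k2 _; rewrite /= /free_act_at free_actU linearZ /= scalerA.
by congr (_ *: _); rewrite fmM /word_act foldr_cat.
Qed.

Lemma free_act1 v : free_act 1 v = v.
Proof. by rewrite free_actU scale1r fm1. Qed.

Lemma free_act_fgen i v : free_act (fgen F i) v = op i v.
Proof. by rewrite free_actU scale1r fmuE. Qed.

Lemma free_act_comm (h : {linear V -> V}) u v :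
  (forall i w, op i (h w) = h (op i w)) -> free_act u (h v) = h (free_act u v).
Proof.
move=> hop; rewrite /free_act linear_sum; apply: eq_bigr => k _.
rewrite linearZ /=; congr (_ *: _); elim: (fmonom_val k) => //= i w ->.
exact: hop.
Qed.

End FreeAction.

(** * The polynomial module *)

Section Model.
Variable F : fieldType.
Local Notation V := {mpoly F[6]}.
Local Notation x := ('X_i0 : V).
Local Notation y := ('X_i1 : V).
Local Notation de := ('X_i2 : V).
Local Notation z := ('X_i3 : V).
Local Notation al := ('X_i4 : V).
Local Notation be := ('X_i5 : V).

(* The map (v, b v, d v) |-> (x v, b (x v), d (x v)) forced by [A, B] = 2D and
   [A, D] + AC - BA = al with C = de - A - B. *)
Definition orbit_step (t : V * V * V) : V * V * V :=
  let: (v, bv, dv) := t in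
  (x * v, x * bv - dv *+ 2,
   x * dv + (de * x - x ^+ 2 - al) * v - x * bv *+ 2 + dv *+ 2).

(** The part of a monomial in the variables that commute with every operator. *)
Definition param (m : 'X_{1..6}) : V :=
  de ^+ m i2 * z ^+ m i3 * al ^+ m i4 * be ^+ m i5.

Section Operators.
Variable g : nat -> V.

(* (v, b v, d v) for v = x^i y^k, when [g k] is prescribed as the value d (y^k). *)
Definition orbit_at (i k : nat) : V * V * V :=
  iter i orbit_step (y ^+ k, y ^+ k.+1, g k).

(** Any [g] gives operators that satisfy the two relations involving A; the remaining relation later
    determines [g] from its value at 0. *)
Definition opB : V -> V := mlift (fun m => param m * (orbit_at (m i0) (m i1)).1.2).
Definition opD : V -> V := mlift (fun m => param m * (orbit_at (m i0) (m i1)).2).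
HB.instance Definition _ := GRing.Linear.on opB.
HB.instance Definition _ := GRing.Linear.on opD.

Lemma orbit_at1 i k : (orbit_at i k).1.1 = x ^+ i * y ^+ k.
Proof.
rewrite /orbit_at; elim: i => [|i]; first by rewrite mul1r.
by rewrite iterS; case: (iter _ _ _) => [[u v] w] /= ->; rewrite exprS mulrA.
Qed.

Lemma mpolyX_orbit m : 'X_[m] = param m * (orbit_at (m i0) (m i1)).1.1.
Proof.
rewrite orbit_at1 mpolyXE_id big_ord6 /param /=; ring.
Qed.

Lemma param_x m : param (U_(i0) + m) = param m.
Proof. by rewrite /param !mnmDE !mnm1E. Qed.

Lemma param_par (i : 'I_6) m : (1 < i)%N -> param (U_(i) + m) = 'X_i * param m.
Proof.
case: i => [[|[|[|[|[|[|//]]]]]] hi] // _; rewrite /param !mnmDE !mnm1E /= !add0n ?add1n;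
  rewrite (bool_irrelevance hi isT) ?exprS; ring.
Qed.

Lemma opB_x p : opB (x * p) = x * opB p - opD p *+ 2.
Proof.
elim/mpolyind: p => [|c m p _ _ IH]; first by rewrite mulr0 !raddf0 mulr0 mul0rn subr0.
rewrite mulrDr -scalerAr !linearP /= IH -mpolyXD.
rewrite /opB /opD !mliftX param_x !mnmDE !mnm1E /= !add0n.
case: (orbit_at _ _) => [[u v] w] /=; rewrite -!mul_mpolyC; ring.
Qed.

Lemma opD_x p :
  opD (x * p) = x * opD p + (de * x - x ^+ 2 - al) * p - x * opB p *+ 2 + opD p *+ 2.
Proof.
elim/mpolyind: p => [|c m p _ _ IH]; first by rewrite !(mulr0, raddf0, mul0rn, addr0, oppr0).
rewrite 2!mulrDr -!scalerAr !linearP /= IH -[x * 'X_[m]]mpolyXD.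
rewrite /opB /opD !mliftX (mpolyX_orbit m) param_x !mnmDE !mnm1E /= !add0n.
case: (orbit_at _ _) => [[u v] w] /=; rewrite -!mul_mpolyC; ring.
Qed.

Lemma opB_par (i : 'I_6) p : (1 < i)%N -> opB ('X_i * p) = 'X_i * opB p.
Proof.
move=> hi; elim/mpolyind: p => [|c m p _ _ IH]; first by rewrite mulr0 raddf0 mulr0.
rewrite mulrDr -scalerAr !linearP /= IH -mpolyXD mulrDr -scalerAr.
by rewrite /opB !mliftX param_par // !mnmDE !mnm1E;
  case: i hi {IH} => [[|[|i]]] //= *; rewrite ?add0n -mulrA.
Qed.

Lemma opD_par (i : 'I_6) p : (1 < i)%N -> opD ('X_i * p) = 'X_i * opD p.
Proof.
move=> hi; elim/mpolyind: p => [|c m p _ _ IH]; first by rewrite mulr0 raddf0 mulr0.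
rewrite mulrDr -scalerAr !linearP /= IH -mpolyXD mulrDr -scalerAr.
by rewrite /opD !mliftX param_par // !mnmDE !mnm1E;
  case: i hi {IH} => [[|[|i]]] //= *; rewrite ?add0n -mulrA.
Qed.

Lemma opB_y k : opB (y ^+ k) = y ^+ k.+1.
Proof.
rewrite mpolyXn /opB mliftX /param !mulmnE !mnm1E /= !mul0n mul1n.
by rewrite !expr0 !mul1r.
Qed.

Lemma opD_y k : opD (y ^+ k) = g k.
Proof.
rewrite mpolyXn /opD mliftX /param !mulmnE !mnm1E /= !mul0n mul1n.
by rewrite !expr0 !mul1r.
Qed.

End Operators.

(** * Degree bounds for the operators *)

Definition degle (d : nat) (p : V) := (msize p <= d.+1)%N.

Lemma degle_le d e p : (d <= e)%N -> degle d p -> degle e p.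
Proof. by move=> de_le /leq_trans; apply. Qed.

Lemma degle0 d : degle d 0.
Proof. by rewrite /degle msize0. Qed.

Lemma degleD d p q : degle d p -> degle d q -> degle d (p + q).
Proof.
by move=> hp hq; apply: leq_trans (msizeD_le _ _) _; rewrite geq_max; apply/andP; split.
Qed.

Lemma degleN d p : degle d p -> degle d (- p).
Proof. by rewrite /degle msizeN. Qed.

Lemma degleB d p q : degle d p -> degle d q -> degle d (p - q).
Proof. by move=> hp hq; apply/degleD/degleN. Qed.

Lemma degleMn d n p : degle d p -> degle d (p *+ n).
Proof.
move=> hp; elim: n => [|n IH]; [exact: degle0 | by rewrite mulrS; exact: degleD].
Qed.

Lemma degleZ d c p : degle d p -> degle d (c *: p).
Proof. exact/leq_trans/msizeZ_le. Qed.

Lemma degleM d e p q : degle d p -> degle e q -> degle (d + e) (p * q).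
Proof.
move=> hp hq; have [->|p0] := eqVneq p 0; first by rewrite mul0r degle0.
have [->|q0] := eqVneq q 0; first by rewrite mulr0 degle0.
by rewrite /degle msizeM // -subn1 leq_subLR add1n -addnS -addSn leq_add.
Qed.

Lemma degle_X i : degle 1 ('X_i : V).
Proof. by rewrite /degle msizeX mdeg1. Qed.

Lemma degle_exp n p : degle 1 p -> degle n (p ^+ n).
Proof.
move=> hp; elim: n => [|n IH]; first by rewrite /degle msize1.
by rewrite exprS -add1n; apply: degleM.
Qed.

Lemma degle_mdeg d p m : degle d p -> m \in msupp p -> (mdeg m <= d)%N.
Proof. by move=> hp /msize_mdeg_lt/leq_trans/(_ hp). Qed.

Lemma degle_mlift d (f : 'X_{1..6} -> V) p :
  (forall m, m \in msupp p -> degle d (f m)) -> degle d (mlift f p).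
Proof.
move=> h; rewrite /mlift big_seq; elim/big_ind: _ => [||m hm].
- exact: degle0.
- exact: degleD.
- by apply/degleZ/h.
Qed.

Lemma mdeg6 (m : 'X_{1..6}) :
  mdeg m = (m i0 + (m i1 + (m i2 + (m i3 + (m i4 + m i5)))))%N.
Proof. by rewrite mdegE big_ord6. Qed.

Lemma degle_param (m : 'X_{1..6}) : degle (m i2 + m i3 + m i4 + m i5) (param m).
Proof.
rewrite /param; do 3!(apply: degleM; last exact/degle_exp/degle_X).
exact/degle_exp/degle_X.
Qed.

Section Degrees.
Variable g : nat -> V.
Hypothesis degle_g : forall k, degle k.+1 (g k).

(** The bounds need a joint induction: the error of b at [x * v] contains [d v], and d at [x * v]
    contains [b v]. *)
Lemma degle_orbit i k :
  degle (i + k) ((orbit_at g i k).1.2 - y * (orbit_at g i k).1.1) /\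
  degle (i + k).+1 (orbit_at g i k).2.
Proof.
elim: i => [|i [IH1 IH2]]; first by rewrite /= -exprS subrr degle0.
move: IH1 IH2 (orbit_at1 g i k); rewrite /orbit_at iterS.
case: (iter _ _ _) => [[v bv] dv] /= h1 h2 hv.
have {hv}hv : degle (i + k) v.
  by rewrite hv; apply: degleM; exact/degle_exp/degle_X.
have hb : degle (i + k).+1 bv.
  rewrite -[bv](subrK (y * v)); apply: degleD; first exact: degle_le h1.
  by rewrite -add1n; apply: degleM => //; exact: degle_X.
have hx p d : degle d p -> degle d.+1 (x * p).
  by move=> hp; rewrite -add1n; apply: degleM => //; exact: degle_X.
split.
  have -> : x * bv - dv *+ 2 - y * (x * v) = x * (bv - y * v) - dv *+ 2 by ring.
  by apply: degleB; [exact: hx | exact: degleMn].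
apply: degleD; last exact/degleMn/(degle_le _ h2).
apply: degleB; last exact/degleMn/hx.
apply: degleD; first exact: hx.
rewrite -[(i + k).+2]/(2 + (i + k))%N; apply: degleM => //.
apply: degleB; last exact: degle_le (degle_X _).
apply: degleB; last exact/degle_exp/degle_X.
by apply: (@degleM 1 1); exact: degle_X.
Qed.

Lemma opB_degle d p : degle d p -> degle d (opB g p - y * p).
Proof.
move=> hp; have -> : opB g p - y * p = mlift (fun m => param m *
   ((orbit_at g (m i0) (m i1)).1.2 - y * (orbit_at g (m i0) (m i1)).1.1)) p.
  rewrite {2}[p]mpolyE mulr_sumr /opB /mlift -sumrB; apply: eq_bigr => m _.
  rewrite mulrBr scalerBr -scalerAr; congr (_ - _ *: _).
  by rewrite (mpolyX_orbit g m) mulrCA.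
apply: degle_mlift => m /(degle_mdeg hp) hm.
have [h _] := degle_orbit (m i0) (m i1).
by apply: degle_le (degleM (degle_param m) h); rewrite mdeg6 in hm; lia.
Qed.

Lemma opB_degleS d p : degle d p -> degle d.+1 (opB g p).
Proof.
move=> hp; rewrite -[opB g p](subrK (y * p)); apply: degleD.
  exact: degle_le (opB_degle hp).
by rewrite -add1n; apply: degleM => //; exact: degle_X.
Qed.

End Degrees.

(* [opB g] on a polynomial of degree at most [j.+1] only involves the values
   [g k] with [k <= j]: a monomial free of [x] does not involve [g] at all. *)
Lemma opB_ext g h j p : (forall k, (k <= j)%N -> g k = h k) ->
  degle j.+1 p -> opB g p = opB h p.
Proof.
move=> gh hp; rewrite /opB /mlift big_seq [RHS]big_seq; apply: eq_bigr => m.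
move/(degle_mdeg hp); rewrite mdeg6 => hm; congr (_ *: (_ * _)).
case: (m i0) hm => [|i] hm //; rewrite /orbit_at gh //; lia.
Qed.

(* Computing d (y^(j+1)) requires b, hence d itself, at d (y^j); the argument [n]
   bounds the depth of this recursion, and any [n > j] is enough. *)
Fixpoint opD_table (n j : nat) : V :=
  match n, j with
  | 0, _ => 0
  | _.+1, 0 => z
  | n.+1, j.+1 => opB (opD_table n) (opD_table n j) - opD_table n j *+ 2
      + (x * y *+ 2 - de * y + y ^+ 2 - be) * y ^+ j
  end.

Lemma opD_table_degle n j : degle j.+1 (opD_table n j).
Proof.
elim: n j => [|n IH] [|j] /=; try exact: degle0; first exact: degle_X.
apply: degleD; first apply: degleB.
- exact: opB_degleS.
- by apply/degleMn/(degle_le _ (IH j)).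
- rewrite -[j.+2]/(2 + j)%N; apply: degleM; last exact/degle_exp/degle_X.
  apply: degleB; last exact: degle_le (degle_X _).
  apply: degleD; last exact/degle_exp/degle_X.
  by apply: degleB; [apply: degleMn|]; apply: (@degleM 1 1); exact: degle_X.
Qed.

Lemma opD_tableS n j : opD_table n.+1 j.+1 =
  opB (opD_table n) (opD_table n j) - opD_table n j *+ 2
  + (x * y *+ 2 - de * y + y ^+ 2 - be) * y ^+ j.
Proof. by []. Qed.

(** The entry at [j] has degree at most [j.+1], so by [opB_ext] applying b to it reads only entries
    up to [j], which are already stable. *)
Lemma opD_table_stable n j : (j < n)%N -> opD_table n.+1 j = opD_table n j.
Proof.
elim: n j => [|n IH] [|j] // hj; rewrite opD_tableS [RHS]opD_tableS IH //.
rewrite (@opB_ext _ (opD_table n) j) //; last exact: opD_table_degle.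
by move=> k hk; apply: IH; exact: leq_ltn_trans hk hj.
Qed.

Definition opD_y_value j := opD_table j.+1 j.

Lemma opD_tableE n j : (j < n)%N -> opD_table n j = opD_y_value j.
Proof.
move=> /subnK <-; elim: (n - _)%N => // k IH.
by rewrite addSn opD_table_stable // ltn_addl.
Qed.

Lemma opD_y_value_degle j : degle j.+1 (opD_y_value j).
Proof. exact: opD_table_degle. Qed.

(** * The relation between B and D on the whole module *)

Local Notation b := (opB opD_y_value).
Local Notation d := (opD opD_y_value).

(** The depth bound disappears: the operator on the right is now the final b, built from all the
    values. *)
Lemma opD_y_valueS j : opD_y_value j.+1 = b (opD_y_value j) - opD_y_value j *+ 2
  + (x * y *+ 2 - de * y + y ^+ 2 - be) * y ^+ j.
Proof.
rewrite {1}/opD_y_value opD_tableS opD_tableE //.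
rewrite (@opB_ext _ opD_y_value j) //; last exact: opD_table_degle.
by move=> k hk; apply: opD_tableE.
Qed.

(* The relation [B, D] + BA - CB = be, rewritten with C = de - A - B and
   BA = AB - 2D. *)
Definition DB_relation p := d (b p) =
  b (d p) - d p *+ 2 + x * b p *+ 2 - de * b p + b (b p) - be * p.

Lemma DB_relation_y k : DB_relation (y ^+ k).
Proof.
rewrite /DB_relation !opB_y !opD_y opD_y_valueS.
rewrite !exprS; ring.
Qed.

(** Once [x] stands to the left of b and d, the hypothesis is needed only to replace [d (b p)]; all
    else cancels, as in the Jacobi identity for A, B, D. *)
Lemma DB_relation_x p : DB_relation p -> DB_relation (x * p).
Proof.
rewrite /DB_relation => h.
(* Multiplied out, so that each product is [x] or a central variable times a vector, as [opB_x] and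
   [opB_par] require. *)
have dx q : d (x * q) = x * d q + de * (x * q) - x * (x * q) - al * q
    - x * b q *+ 2 + d q *+ 2 by rewrite opD_x; ring.
have bB u v : b (u - v) = b u - b v by exact: raddfB.
have bD u v : b (u + v) = b u + b v by exact: raddfD.
have bM u : b (u *+ 2) = b u *+ 2 by exact: raddfMn.
have dB u v : d (u - v) = d u - d v by exact: raddfB.
have dM u : d (u *+ 2) = d u *+ 2 by exact: raddfMn.
have -> : d (b (x * p)) = d (x * b p) - d (d p) *+ 2 by rewrite opB_x dB dM.
have -> : b (d (x * p)) = b (x * d p) + de * b (x * p) - b (x * (x * p)) - al * b p
    - b (x * b p) *+ 2 + b (d p) *+ 2
  by rewrite dx bD !bB bD !bM (@opB_par _ i2) // (@opB_par _ i4).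
have -> : b (b (x * p)) = b (x * b p) - b (d p) *+ 2 by rewrite [b (x * p)]opB_x bB bM.
rewrite (opB_x _ (x * p)) !dx (opB_x _ p) (opB_x _ (b p)) (opB_x _ (d p)) h; ring.
Qed.

Lemma DB_relation_par (i : 'I_6) p :
  (1 < i)%N -> DB_relation p -> DB_relation ('X_i * p).
Proof.
by rewrite /DB_relation => hi h; rewrite !(opB_par, opD_par) // h; ring.
Qed.

(** Monomials arise from powers of [y] by multiplication with [x] and the central variables, and
    both preserve the relation. *)
Lemma opDB p : DB_relation p.
Proof.
elim/mpolyind: p => [|c m p _ _ IH]; first by rewrite /DB_relation !(raddf0, mulr0); ring.
suff h : DB_relation 'X_[m].
  move: h IH; rewrite /DB_relation !linearP /= => -> ->.
  by rewrite -!mul_mpolyC; ring.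
have hX n (q r : V) : (forall p, DB_relation p -> DB_relation (q * p)) ->
    DB_relation r -> DB_relation (q ^+ n * r).
  by move=> hq hr; elim: n => [|n hn]; rewrite ?mul1r // exprS -mulrA; exact: hq.
rewrite (mpolyX_orbit opD_y_value) orbit_at1 /param -!mulrA.
do 4!(apply: (hX) => [q|]; first exact: DB_relation_par).
apply: (hX) => [q|]; [exact: DB_relation_x|exact: DB_relation_y].
Qed.

(** * The action of the free algebra and of its quotient [racah] *)

Import monalg.
Import mpoly.

Definition mulV (q : V) : {linear V -> V} := q \*o idfun.
Definition opC : {linear V -> V} := (mulV de \- mulV x) \- b.

Definition model_op (i : 'I_4) : {linear V -> V} :=
  match val i with
  | 0 => mulV x | 1 => b | 2 => opC | _ => d
  end.

Local Notation act := (free_act model_op).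

Lemma act_fA p : act (fA F) p = x * p. Proof. exact: free_act_fgen. Qed.
Lemma act_fB p : act (fB F) p = b p. Proof. exact: free_act_fgen. Qed.
Lemma act_fC p : act (fC F) p = de * p - x * p - b p. Proof. exact: free_act_fgen. Qed.
Lemma act_fD p : act (fD F) p = d p. Proof. exact: free_act_fgen. Qed.

Lemma actD u w p : act (u + w) p = act u p + act w p.
Proof. exact: (linearD (free_act_at model_op p)). Qed.
Lemma actB u w p : act (u - w) p = act u p - act w p.
Proof. exact: (linearB (free_act_at model_op p)). Qed.
Lemma actMn u n p : act (u *+ n) p = act u p *+ n.
Proof. exact: (linearMn (free_act_at model_op p)). Qed.
Lemma act0 p : act 0 p = 0.
Proof. exact: (linear0 (free_act_at model_op p)). Qed.

Lemma act_lie u w p : act (lie u w) p = act u (act w p) - act w (act u p).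
Proof.
exact: etrans (actB _ _ _)
  (congr2 (fun p q => p - q) (free_actM _ _ _ _) (free_actM _ _ _ _)).
Qed.

(** Stated for arbitrary elements because [beta_of] and [gamma_of] are [alpha_of] with A, B, C
    permuted cyclically. *)
Lemma act_alpha_of u v w t p : act (alpha_of u v w t) p =
  act u (act t p) - act t (act u p) + act u (act w p) - act v (act u p).
Proof.
rewrite -act_lie -!free_actM.
exact: etrans (actB _ _ _) (congr1 (fun q => q - _) (actD _ _ _)).
Qed.

Lemma model_op_par (j : 'I_6) : (1 < j)%N ->
  forall i p, model_op i ('X_j * p) = 'X_j * model_op i p.
Proof.
move=> hj [[|[|[|[|//]]]] hi] p; rewrite /model_op /=;
  rewrite ?opB_par ?opD_par //; ring.
Qed.

Lemma act_par (j : 'I_6) u p : (1 < j)%N -> act u ('X_j * p) = 'X_j * act u p.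
Proof.
by move=> hj; apply: (free_act_comm (h := mulV 'X_j)) => i q; apply: model_op_par.
Qed.

Let bB u v : b (u - v) = b u - b v. Proof. exact: raddfB. Qed.
Let dB u v : d (u - v) = d u - d v. Proof. exact: raddfB. Qed.

Section Relations.
Variables A B C D : free4 F.
Hypothesis actA : forall p, act A p = x * p.
Hypothesis actB : forall p, act B p = b p.
Hypothesis actC : forall p, act C p = de * p - x * p - b p.
Hypothesis actD : forall p, act D p = d p.
Let actE := (actA, actB, actC, actD).

Lemma act_lieAB p : act (lie A B) p = d p *+ 2.
Proof. by rewrite act_lie !actE opB_x; ring. Qed.

Lemma act_lieBC p : act (lie B C) p = d p *+ 2.
Proof. by rewrite act_lie !actE !bB (@opB_par _ i2) // opB_x; ring. Qed.

Lemma act_lieCA p : act (lie C A) p = d p *+ 2.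
Proof. by rewrite act_lie !actE opB_x; ring. Qed.

Lemma act_alpha p : act (alpha_of A B C D) p = al * p.
Proof. by rewrite act_alpha_of !actE opD_x opB_x; ring. Qed.

Lemma act_beta p : act (beta_of A B C D) p = be * p.
Proof.
by rewrite -[beta_of _ _ _ _]/(alpha_of _ _ _ _) act_alpha_of !actE opB_x (opDB p); ring.
Qed.

(** The three elements add up to $[A+B+C,D]$, and $A+B+C$ acts as [de], which commutes with d. *)
Lemma act_gamma p : act (gamma_of A B C D) p = - (al + be) * p.
Proof.
rewrite -[gamma_of _ _ _ _]/(alpha_of _ _ _ _) act_alpha_of !actE.
by rewrite !dB (@opD_par _ i2) // opD_x (opDB p); ring.
Qed.

End Relations.

Lemma act_racah_rel u p : ideal_gen (racah_rel (F := F)) u -> act u p = 0.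
Proof.
(* Centrality: alpha, beta, gamma act as multiplication by a polynomial [q] in the central
   variables, and this commutes with every [act w]. *)
have hlie u0 w q r : (forall p, act u0 p = q * p) ->
    (forall p, act w (q * p) = q * act w p) -> act (lie u0 w) r = 0.
  by move=> hu hw; rewrite act_lie hu hu hw subrr.
move=> h; elim: h p => {u} [u hu|p|u w _ IHu _ IHw p|u w _ IHw p|u w _ IHw p].
- case: hu => [||| w|w|w] p.
  + rewrite (actB (lie (fA F) (fB F))) actMn act_fD.
    by rewrite (act_lieAB act_fA act_fB) subrr.
  + rewrite (actB (lie (fB F) (fC F))) actMn act_fD.
    by rewrite (act_lieBC act_fB act_fC) subrr.
  + rewrite (actB (lie (fC F) (fA F))) actMn act_fD.
    by rewrite (act_lieCA act_fA act_fC) subrr.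
  + apply: (hlie _ _ al) => q; last exact: act_par.
    exact: (act_alpha act_fA act_fB act_fC act_fD).
  + apply: (hlie _ _ be) => q; last exact: act_par.
    exact: (act_beta act_fA act_fB act_fC act_fD).
  + apply: (hlie _ _ (- (al + be))) => q.
      exact: (act_gamma act_fA act_fB act_fC act_fD).
    by rewrite mulNr linearN /= mulrDl linearD /= !act_par // mulNr mulrDl.
- exact: act0.
- by rewrite actD IHu IHw addr0.
- by rewrite free_actM IHw linear0.
- by rewrite free_actM IHw.
Qed.

(** Uses the chosen representative; [racah_act_proj] shows that any other gives the same result. *)
Definition racah_act (u : racah F) (p : V) : V := act (repr u) p.

Lemma racah_act_proj w p : racah_act (proj _ w) p = act w p.
Proof.
apply/eqP; rewrite -subr_eq0 -actB; apply/eqP/act_racah_rel.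
by apply/ideal_predP/projP; rewrite reprK_proj.
Qed.

Lemma racah_act_linear p : linear (racah_act^~ p).
Proof.
move=> c u v.
have [[u' ->] [v' ->]] := (proj_surj u, proj_surj v).
rewrite -projZ -projD !racah_act_proj.
exact: (linearP (free_act_at model_op p)).
Qed.

Definition racah_act_at p : {linear racah F -> V} :=
  HB.pack_for {linear racah F -> V} (racah_act^~ p)
    (GRing.isLinear.Build F (racah F) V _ (racah_act^~ p) (racah_act_linear p)).

Lemma racah_actM u v p : racah_act (u * v) p = racah_act u (racah_act v p).
Proof.
have [[u' ->] [v' ->]] := (proj_surj u, proj_surj v).
by rewrite -projM !racah_act_proj free_actM.
Qed.

Lemma racah_act1 p : racah_act 1 p = p.
Proof. exact: etrans (racah_act_proj 1 p) (free_act1 _ _). Qed.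

Lemma racah_actX u n p : racah_act (u ^+ n) p = iter n (racah_act u) p.
Proof.
elim: n => [|n IH]; first by rewrite expr0 racah_act1.
by rewrite exprS racah_actM IH.
Qed.

Lemma racah_act_A p : racah_act (rA F) p = x * p.
Proof. by rewrite /rA racah_act_proj act_fA. Qed.

Lemma racah_act_B p : racah_act (rB F) p = b p.
Proof. by rewrite /rB racah_act_proj act_fB. Qed.

Lemma racah_act_C p : racah_act (rC F) p = de * p - x * p - b p.
Proof. by rewrite /rC racah_act_proj act_fC. Qed.

Lemma racah_act_D p : racah_act (rD F) p = d p.
Proof. by rewrite /rD racah_act_proj act_fD. Qed.

Lemma racah_act_alpha p : racah_act (ralpha F) p = al * p.
Proof.
by rewrite /ralpha -proj_alpha racah_act_proj (act_alpha act_fA act_fB act_fC act_fD).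
Qed.

Lemma racah_act_beta p : racah_act (rbeta F) p = be * p.
Proof.
by rewrite /rbeta -proj_beta racah_act_proj (act_beta act_fA act_fB act_fC act_fD).
Qed.

(** * Leading monomials and independence *)

Definition shift_tuple : 6.-tuple V := [tuple x; y; de + x + y; z; al; be].
Local Notation th := (comp_mpoly shift_tuple).

Lemma shift_X i : th 'X_i = shift_tuple`_i.
Proof. exact: comp_mpolyXU. Qed.

Lemma shift_degle n p : degle n p -> degle n (th p).
Proof.
move=> hp; rewrite comp_mpolyEX big_seq.
elim/big_ind: _ => [||m /(degle_mdeg hp) hm].
- exact: degle0.
- exact: degleD.
apply/degleZ/(degle_le hm); rewrite comp_mpolyX mdegE.
apply: (big_rec2 (fun p n => degle n p)) => [|i p' n' _ h].
  by rewrite /degle msize1.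
apply: degleM => //; apply: degle_exp.
case: i {h} => [[|[|[|[|[|[|//]]]]]] hi]; rewrite (tnth_nth 0) /=;
  do ?apply: degleD; exact: degle_X.
Qed.

(** [degle] cannot express the bound 0, which means [p = 0], so this case is separate. *)
Lemma msizeX_le i n (p : V) : (msize p <= n)%N -> (msize ('X_i * p) <= n.+1)%N.
Proof.
case: n => [|n].
  by rewrite leqn0 msize_poly_eq0 => /eqP ->; rewrite mulr0 msize0.
by move=> hp; apply: (@degleM 1 n); [exact: degle_X|].
Qed.

(** The leading monomial is read after the substitution, but the operators act before it; the degree
    of [p] itself is kept to bound the error of b. *)
Definition lead (m : 'X_{1..6}) (p : V) :=
  degle (mdeg m) p /\ (msize (th p - 'X_[m]) <= mdeg m)%N.

Let degle_b p n : degle n p -> degle n (b p - y * p).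
Proof. by apply: opB_degle; exact: opD_y_value_degle. Qed.

Lemma lead_A m p : lead m p -> lead (U_(i0) + m) (racah_act (rA F) p).
Proof.
rewrite /lead racah_act_A mdegD mdeg1 => -[h1 h2]; split.
  by apply: degleM => //; exact: degle_X.
rewrite rmorphM /= shift_X /= mpolyXD -mulrBr; exact: msizeX_le.
Qed.

Lemma lead_B m p : lead m p -> lead (U_(i1) + m) (racah_act (rB F) p).
Proof.
rewrite /lead racah_act_B mdegD mdeg1 => -[h1 h2]; split.
  by apply: opB_degleS => //; exact: opD_y_value_degle.
have -> : th (b p) - 'X_[U_(i1) + m] = th (b p - y * p) + y * (th p - 'X_[m]).
  by rewrite rmorphB rmorphM /= shift_X /= mpolyXD; ring.
apply: leq_trans (msizeD_le _ _) _; rewrite geq_max msizeX_le // andbT.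
exact/shift_degle/degle_b.
Qed.

Lemma lead_C m p : lead m p -> lead (U_(i2) + m) (racah_act (rC F) p).
Proof.
rewrite /lead racah_act_C mdegD mdeg1 => -[h1 h2]; split.
  apply: degleB; first by apply: degleB; apply: degleM => //; exact: degle_X.
  by apply: opB_degleS => //; exact: opD_y_value_degle.
(* The substitution sends [de - x - y] to [de], so only the error of b is left over. *)
have -> : th (de * p - x * p - b p) - 'X_[U_(i2) + m] =
    de * (th p - 'X_[m]) - th (b p - y * p).
  by rewrite !rmorphB !rmorphM /= !shift_X /= mpolyXD; ring.
apply: leq_trans (msizeD_le _ _) _; rewrite geq_max msizeX_le //= msizeN.
exact/shift_degle/degle_b.
Qed.

Lemma lead_iter (f : V -> V) i m n p :
  (forall m p, lead m p -> lead (U_(i) + m) (f p)) ->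
  lead m p -> lead (U_(i) *+ n + m) (iter n f p).
Proof.
move=> hf hp; elim: n => [|n IH]; first by rewrite mulm0n add0m.
by rewrite mulmS -addmA iterS; apply: hf.
Qed.

Definition multinom6 (t : nat * nat * nat * nat * nat * nat) : 'X_{1..6} :=
  let: (i, j, k, l, r, s) := t in
  (U_(i0) *+ i + (U_(i1) *+ j + (U_(i2) *+ k +
   (U_(i3) *+ l + (U_(i4) *+ r + U_(i5) *+ s)))))%MM.

Lemma multinom6_inj : injective multinom6.
Proof.
move=> [[[[[i j] k] l] r] s] [[[[[i' j'] k'] l'] r'] s'] /mnmP e.
move: (e i0) (e i1) (e i2) (e i3) (e i4) (e i5).
rewrite !mnmDE !mulmnE !mnm1E /= !(mul0n, mul1n, add0n, addn0).
by do 6!move=> ->.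
Qed.

Lemma racah_act_iter (u : racah F) (c : V) n q :
  (forall p, racah_act u p = c * p) -> iter n (racah_act u) q = c ^+ n * q.
Proof.
move=> hu; elim: n => [|n IH]; first by rewrite mul1r.
by rewrite iterS IH hu exprS mulrA.
Qed.

(** On 1 the powers of D, alpha, beta give exactly a monomial in [z], [al], [be], because d sends 1
    to [z] and commutes with these variables. The powers of C, B, A then each contribute a leading
    factor. *)
Lemma lead_monomial (t : nat * nat * nat * nat * nat * nat) :
  let: (i, j, k, l, r, s) := t in
  lead (multinom6 t) (racah_act
    (rA F ^+ i * rB F ^+ j * rC F ^+ k * rD F ^+ l * ralpha F ^+ r * rbeta F ^+ s) 1).
Proof.
move: t => [[[[[i j] k] l] r] s]; rewrite !racah_actM !racah_actX.
apply: (lead_iter _ (@lead_A)); apply: (lead_iter _ (@lead_B)); apply: (lead_iter _ (@lead_C)).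
have d_iter n q : d q = z * q -> iter n (racah_act (rD F)) q = z ^+ n * q.
  move=> hq; elim: n => [|n IH]; first by rewrite mul1r.
  rewrite iterS IH racah_act_D exprS.
  elim: n {IH} => [|n IH]; first by rewrite mulr1 !mul1r.
  by rewrite exprS -!mulrA opD_par // IH; ring.
rewrite (racah_act_iter s _ racah_act_beta) (racah_act_iter r _ racah_act_alpha).
rewrite (d_iter l); last first.
  have d1 : d 1 = z by rewrite -(expr0 y) opD_y.
  have dp (c : 'I_6) n q : (1 < c)%N -> d q = z * q -> d ('X_c ^+ n * q) = z * ('X_c ^+ n * q).
    move=> hc hq; elim: n => [|n IH]; first by rewrite !mul1r.
    by rewrite exprS -!mulrA opD_par // IH; ring.
  by apply: (dp) => //; apply: (dp); rewrite // d1 mulr1.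
rewrite mulr1 !mpolyXn -!mpolyXD; split; first by rewrite /degle msizeX.
rewrite !mpolyXD -!mpolyXn !rmorphM !rmorphXn /= !shift_X /= subrr msize0; exact: leq0n.
Qed.

Lemma monomials_lin_indep :
  lin_indep (fun m : nat * nat * nat * nat * nat * nat =>
    let: (i, j, k, l, r, s) := m in
    rA F ^+ i * rB F ^+ j * rC F ^+ k * rD F ^+ l * ralpha F ^+ r * rbeta F ^+ s).
Proof.
(* A relation in the algebra is evaluated at the vector 1 and then shifted; both maps are linear. *)
apply: (lin_indep_linear (f := racah_act_at 1)).
apply: (lin_indep_linear (f := th)).
apply: lead_lin_indep multinom6_inj _ => t.
by have := lead_monomial t; move: t => [[[[[i j] k] l] r] s] [].
Qed.

End Model.

(** * Spanning *)

Section Span.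
Variables (F : fieldType) (V : lmodType F) (J : eqType) (v : J -> V).

(** Lists of pairs may repeat an index, so sums are concatenations; [in_span_all] collects the
    coefficients. *)
Definition in_span (x : V) :=
  exists l : seq (F * J), x = \sum_(p <- l) p.1 *: v p.2.

Lemma in_span0 : in_span 0.
Proof. by exists [::]; rewrite big_nil. Qed.

Lemma in_span_mem j : in_span (v j).
Proof. by exists [:: (1, j)]; rewrite big_seq1 scale1r. Qed.

Lemma in_spanD x y : in_span x -> in_span y -> in_span (x + y).
Proof. by move=> [l ->] [l' ->]; exists (l ++ l'); rewrite big_cat. Qed.

Lemma in_spanZ c x : in_span x -> in_span (c *: x).
Proof.
move=> [l ->]; exists [seq (c * p.1, p.2) | p <- l].
by rewrite big_map scaler_sumr; apply: eq_bigr => p _; rewrite scalerA.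
Qed.

Lemma in_span_all : (forall x, in_span x) -> lin_span v.
Proof.
move=> h x; have [l ->] := h x.
(* Each index is listed once, since its coefficient already gathers all its occurrences in [l]. *)
exists (undup (map snd l)), (fun j => \sum_(p <- l | p.2 == j) p.1).
under [RHS]eq_bigr do rewrite scaler_suml.
rewrite (exchange_big_dep xpredT) //= big_seq [RHS]big_seq.
apply: eq_bigr => p pl; rewrite -big_filter.
rewrite (_ : filter _ _ = [:: p.2]) ?big_seq1 //.
rewrite (eq_filter (a2 := pred1 p.2)) => [|j]; last exact: eq_sym.
by rewrite filter_pred1_uniq ?undup_uniq // mem_undup map_f.
Qed.

End Span.

(** * Words filtered by weight *)

Section WordFiltration.
Variables (F : fieldType) (R : algType F) (I : eqType) (X : I -> R) (wt : I -> nat).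

Definition word (w : seq I) : R := \prod_(i <- w) X i.
Definition word_wt (w : seq I) : nat := (\sum_(i <- w) wt i)%N.

(** The linear span of the words of weight less than [n]: a step of the weight filtration. *)
Inductive below (n : nat) : R -> Prop :=
| below_word w : (word_wt w < n)%N -> below n (word w)
| below0 : below n 0
| belowD x y : below n x -> below n y -> below n (x + y)
| belowZ c x : below n x -> below n (c *: x).

Lemma belowN n x : below n x -> below n (- x).
Proof. by rewrite -scaleN1r; exact: belowZ. Qed.

Lemma belowB n x y : below n x -> below n y -> below n (x - y).
Proof. by move=> hx hy; apply/belowD/belowN. Qed.

Lemma below_le m n x : (m <= n)%N -> below m x -> below n x.
Proof.
move=> mn; elim=> [w hw||y z _ hy _ hz|c y _ hy].
- by apply/below_word/(leq_trans hw).
- exact: below0.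
- exact: belowD.
- exact: belowZ.
Qed.

Lemma below_gen n i : (wt i < n)%N -> below n (X i).
Proof.
by move=> h; have := @below_word n [:: i]; rewrite /word /word_wt !big_seq1; apply.
Qed.

Lemma below_gen2 n i j : (wt i + wt j < n)%N -> below n (X i * X j).
Proof.
by move=> h; have := @below_word n [:: i; j]; rewrite /word /word_wt !big_cons !big_nil
  mulr1 addn0; apply.
Qed.

Lemma below_mull n w x : below n x -> below (word_wt w + n) (word w * x).
Proof.
elim=> [w' hw||y z _ hy _ hz|c y _ hy].
- rewrite /word -big_cat; apply: below_word.
  by rewrite /word_wt big_cat /= ltn_add2l.
- by rewrite mulr0; exact: below0.
- by rewrite mulrDr; exact: belowD.
- by rewrite -scalerAr; exact: belowZ.
Qed.

Lemma below_mulr n w x : below n x -> below (n + word_wt w) (x * word w).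
Proof.
elim=> [w' hw||y z _ hy _ hz|c y _ hy].
- rewrite /word -big_cat; apply: below_word.
  by rewrite /word_wt big_cat /= ltn_add2r.
- by rewrite mul0r; exact: below0.
- by rewrite mulrDl; exact: belowD.
- by rewrite -scalerAl; exact: belowZ.
Qed.

Hypothesis lie_below : forall i j, below (wt i + wt j) (lie (X i) (X j)).

Lemma word_cons i w : word (i :: w) = X i * word w.
Proof. exact: big_cons. Qed.
Lemma word_wt_cons i w : word_wt (i :: w) = (wt i + word_wt w)%N.
Proof. exact: big_cons. Qed.
Lemma word1 i : word [:: i] = X i.
Proof. exact: big_seq1. Qed.
Lemma word_wt1 i : word_wt [:: i] = wt i.
Proof. exact: big_seq1. Qed.

Lemma word_move i u w :
  below (word_wt (i :: u ++ w)) (word (u ++ i :: w) - word (i :: u ++ w)).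
Proof.
elim: u => [|j u IH] /=; first by rewrite subrr; exact: below0.
(* First [i] moves to the front of [u], then it is exchanged with [j]. *)
have -> : word (j :: u ++ i :: w) - word [:: i, j & u ++ w] =
    word [:: j] * (word (u ++ i :: w) - word (i :: u ++ w))
    + lie (X j) (X i) * word (u ++ w).
  rewrite /lie word1 !word_cons mulrBr mulrBl !mulrA.
  by rewrite addrA subrK.
apply: belowD.
  by apply: below_le (below_mull [:: j] IH); rewrite word_wt1 !word_wt_cons; lia.
apply: below_le (below_mulr (u ++ w) (lie_below j i)).
by rewrite !word_wt_cons; lia.
Qed.

(** The associated graded algebra is commutative: bringing the first letter of [u] to the front of
    [w] costs only lower weight, and induction handles the rest. *)
Lemma word_perm u w : perm_eq u w -> below (word_wt u) (word u - word w).
Proof.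
elim: u w => [|i u IH] w uw.
  by move: uw; rewrite perm_sym => /perm_nilP ->; rewrite subrr; exact: below0.
have /splitPr iw : i \in w by rewrite -(perm_mem uw) mem_head.
case: iw uw => w1 w2 uw.
have uw' : perm_eq u (w1 ++ w2).
  by rewrite -(perm_cons i) (perm_trans uw) // (perm_catCA w1 [:: i] w2).
have -> : word (i :: u) - word (w1 ++ i :: w2) =
    word [:: i] * (word u - word (w1 ++ w2))
    - (word (w1 ++ i :: w2) - word (i :: w1 ++ w2)).
  by rewrite word1 !word_cons mulrBr opprB addrA subrK.
apply: belowB.
  by apply: below_le (below_mull [:: i] (IH _ uw')); rewrite word_wt1 word_wt_cons.
apply: below_le (word_move i w1 w2).
by rewrite /word_wt (perm_big _ uw) (perm_big _ (permEl (perm_catCA w1 [:: i] w2))) leqnn.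
Qed.

Variables (J : eqType) (v : J -> R).
Hypothesis reorder : forall w, exists2 u, perm_eq w u & in_span v (word u).

(** Induction on the weight bound: a word differs from a reordering in the span by words of weight
    below its own. *)
Lemma below_span n x : below n x -> in_span v x.
Proof.
elim: n x => [|n IH] x; elim=> {x} [w //||x y _ hx _ hy|c x _ hx];
  try exact: in_span0; try exact: in_spanD; try exact: in_spanZ.
move=> hw; have [u wu hu] := reorder w.
rewrite -[word w](subrK (word u)); apply: in_spanD hu.
exact/IH/(below_le _ (word_perm wu)).
Qed.

Lemma word_span w : in_span v (word w).
Proof. by apply: (@below_span (word_wt w).+1); exact: below_word. Qed.

End WordFiltration.

(** * Commutators and ordered words for the Racah relations *)

Section RacahRelations.
Variables (F : fieldType) (hF : 2%N \notin [pchar F]) (R : algType F) (A B C D : R).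
Local Notation al := (alpha_of A B C D).
Local Notation be := (beta_of A B C D).
Local Notation ga := (gamma_of A B C D).
Hypothesis lieAB : lie A B = D *+ 2.
Hypothesis lieBC : lie B C = D *+ 2.
Hypothesis lieCA : lie C A = D *+ 2.
Hypothesis central_al : forall u, al * u = u * al.
Hypothesis central_be : forall u, be * u = u * be.

Lemma lie_sum_D0 : lie (A + B + C) D = 0.
Proof.
have lieN (u w : R) : lie u w = - lie w u by rewrite /lie opprB.
have commP (u w : R) : lie u w = 0 -> GRing.comm u w.
  by move/eqP; rewrite subr_eq0 => /eqP.
have lieDl (u u' w : R) : lie (u + u') w = lie u w + lie u' w.
  by rewrite /lie mulrDl mulrDr opprD addrACA.
have lieuu (u : R) : lie u u = 0 by rewrite /lie subrr.
have cA : GRing.comm (A + B + C) A.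
  by apply: commP; rewrite !lieDl lieuu (lieN B) lieAB lieCA add0r addNr.
have cB : GRing.comm (A + B + C) B.
  by apply: commP; rewrite !lieDl lieuu (lieN C) lieAB lieBC addr0 addrN.
have : GRing.comm (A + B + C) (D *+ 2).
  by rewrite -lieAB; apply: commrB; apply: commrM.
rewrite /GRing.comm => /eqP; rewrite -subr_eq0 mulrnAr mulrnAl -mulrnBl => /eqP h.
apply/eqP; have : (2%:R : F) *: lie (A + B + C) D = 0 by rewrite scaler_nat.
move/eqP; rewrite scaler_eq0 => /orP[h2|//].
by move: hF; rewrite inE /= h2.
Qed.

(** The products AC, BA, CB cancel in alpha + beta + gamma, which leaves $[A+B+C,D]=0$. *)
Lemma gamma_ofE : ga = - (al + be).
Proof.
have telescope (a b c p q r : R) :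
    a + p - q + (b + q - r) + (c + r - p) = a + b + c.
  rewrite -!(addrA _ _ (- _)) (addrACA a) (addrA (p - q)) subrK (addrACA (a + b)).
  by rewrite (addrA (p - r)) subrK subrr addr0.
apply/eqP; rewrite -subr_eq0 opprK addrC telescope; apply/eqP.
rewrite -lie_sum_D0 /lie !mulrDl !mulrDr !opprD.
by rewrite (addrACA (A * D)) (addrACA (A * D + B * D)).
Qed.

Definition gens (i : 'I_6) : R := nth 0 [:: A; B; C; D; al; be] i.
(** The weights make 2D lighter than AB (3 < 4), and alpha, AC and BA lighter than AD (4 < 5). *)
Definition gens_wt (i : 'I_6) : nat := nth 0%N [:: 2; 2; 2; 3; 4; 4]%N i.

Lemma gens_lie_below i j :
  below gens gens_wt (gens_wt i + gens_wt j) (lie (gens i) (gens j)).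
Proof.
set P := below gens gens_wt.
have lieN (u w : R) : lie u w = - lie w u by rewrite /lie opprB.
have lieuu (u : R) : lie u u = 0 by rewrite /lie subrr.
have Ngen k n : (gens_wt k < n)%N -> P n (gens k) by exact: below_gen.
have gen2 k l n : (gens_wt k + gens_wt l < n)%N ->
  P n (gens k * gens l) by exact: below_gen2.
have PN n u w : P n (lie u w) -> P n (lie w u) by rewrite (lieN w u); exact: belowN.
have al0 u : lie al u = 0 by rewrite /lie central_al subrr.
have be0 u : lie be u = 0 by rewrite /lie central_be subrr.
(* Solves the definitions of alpha, beta, gamma for the commutator with D. *)
have lieD (a p q u : R) : u = a + p - q -> a = u - p + q.
  by move=> ->; rewrite (addrAC (a + p)) addrK subrK.
have P2D : P 4 (D *+ 2) by apply: belowD; exact: (Ngen i3).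
have PAB : P 4 (lie A B) by rewrite lieAB.
have PBC : P 4 (lie B C) by rewrite lieBC.
have PCA : P 4 (lie C A) by rewrite lieCA.
have PAD : P 5 (lie A D).
  rewrite (lieD (lie A D) (A * C) (B * A) al) //; apply: belowD; last exact: (gen2 i1 i0).
  by apply: belowB; [exact: (Ngen i4) | exact: (gen2 i0 i2)].
have PBD : P 5 (lie B D).
  rewrite (lieD (lie B D) (B * A) (C * B) be) //; apply: belowD; last exact: (gen2 i2 i1).
  by apply: belowB; [exact: (Ngen i5) | exact: (gen2 i1 i0)].
have PCD : P 5 (lie C D).
  rewrite (lieD (lie C D) (C * B) (A * C) ga) //.
  apply: belowD; last exact: (gen2 i0 i2).
  apply: belowB; last exact: (gen2 i2 i1).
  (* Gamma is not among the six generators and is expressed through alpha and beta. *)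
  by rewrite gamma_ofE; apply/belowN/belowD; [exact: (Ngen i4) | exact: (Ngen i5)].
case: i j => [[|[|[|[|[|[|//]]]]]] hi] [[|[|[|[|[|[|//]]]]]] hj];
  rewrite /gens /gens_wt /=; rewrite ?lieuu ?al0 ?be0;
  by [exact: below0 | | exact: PN | apply: PN; rewrite ?al0 ?be0; exact: below0].
Qed.

Lemma word_nseq (X : 'I_6 -> R) n i : word X (nseq n i) = X i ^+ n.
Proof. by rewrite /word big_nseq iter_mulr_1. Qed.

Lemma word_cat (X : 'I_6 -> R) u w : word X (u ++ w) = word X u * word X w.
Proof. exact: big_cat. Qed.

Local Notation mono := (fun m : nat * nat * nat * nat * nat * nat =>
    let: (i, j, k, l, r, s) := m in
    A ^+ i * B ^+ j * C ^+ k * D ^+ l * al ^+ r * be ^+ s).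

Lemma gens_reorder w : exists2 u, perm_eq w u & in_span mono (word gens u).
Proof.
(* The sorted word: one block per letter, with the multiplicity it has in [w]. *)
pose c i := count_mem (i : 'I_6) w; pose blk i := nseq (c i) i.
exists (blk i0 ++ blk i1 ++ blk i2 ++ blk i3 ++ blk i4 ++ blk i5).
  apply/allP => i _; apply/eqP; rewrite !count_cat !count_nseq.
  by case: i => [[|[|[|[|[|[|//]]]]]] hi] /=; rewrite !(mul0n, mul1n, add0n, addn0) /c;
    apply: eq_count => k; rewrite /= -!val_eqE.
rewrite !word_cat !word_nseq !mulrA.
exact: (in_span_mem mono (c i0, c i1, c i2, c i3, c i4, c i5)).
Qed.

End RacahRelations.

(** * From the free algebra to words in the generators *)

Section FreeWords.
Import monalg.
Variables (F : fieldType).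
Local Notation racah_gen := (gens (rA F) (rB F) (rC F) (rD F)).

(** Images of free words use only A, B, C, D; alpha and beta enter through commutators when words
    are sorted. *)
Definition letter (i : 'I_4) : 'I_6 := widen_ord (isT : (4 <= 6)%N) i.

Lemma proj_fgen i : proj (@racah_rel F) (fgen F i) = racah_gen (letter i).
Proof.
by case: i => [[|[|[|[|//]]]] hi]; rewrite (bool_irrelevance hi isT).
Qed.

Lemma proj_word (k : {fmonom 'I_4}) :
  proj (@racah_rel F) << k >> = word racah_gen (map letter k).
Proof.
case: k => s; elim: s => [|i s IH].
  rewrite /word big_nil; have -> : FMonom [::] = mone :> {fmonom 'I_4}.
    by apply/val_inj; rewrite /= fm1.
  exact: (rmorph1 (proj (@racah_rel F))).
have -> : FMonom (i :: s) = mmul (fmu i) (FMonom s).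
  by apply/val_inj; rewrite /= fmM fmU.
have -> : << mmul (fmu i) (FMonom s) >> = fgen F i * << FMonom s >> :> free4 F.
  by rewrite malgM_def fgmulUU mulr1.
rewrite projM IH proj_fgen fmM fmU; exact/esym/(word_cons racah_gen (letter i) (map letter s)).
Qed.

Lemma racah_in_span (J : eqType) (v : J -> racah F) :
  (forall w, in_span v (word racah_gen w)) -> forall x, in_span v x.
Proof.
move=> hw x; have [u ->] := proj_surj x; rewrite (monalgE u) rmorph_sum /=.
elim/big_ind: _ => [||k _]; [exact: in_span0|exact: in_spanD|].
have -> : << monalg.mcoeff k u *g k >> = monalg.mcoeff k u *: << k >> :> free4 F.
  by apply/malgP => k'; rewrite monalg.mcoeffZ !monalg.mcoeffU mulrnAr mulr1.
by rewrite projZ proj_word; apply: in_spanZ.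
Qed.

End FreeWords.

Theorem theorem2p4 (F : fieldType) (hF : 2%N \notin [pchar F]) :
  is_basis (fun m : nat * nat * nat * nat * nat * nat =>
    let: (i, j, k, l, r, s) := m in
    rA F ^+ i * rB F ^+ j * rC F ^+ k * rD F ^+ l * ralpha F ^+ r * rbeta F ^+ s).
Proof.
split; first exact: monomials_lin_indep.
(* Sorted words are the claimed monomials, so only the weight bound on commutators remains. *)
apply/in_span_all/racah_in_span/word_span/gens_reorder.
exact: (gens_lie_below hF (racah_AB F) (racah_BC F) (racah_CA F)
  (@racah_alpha_central F) (@racah_beta_central F)).
Qed.
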